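(* Let $n \geq 2$ be an integer and $q = 2^n$. Then $|\mathrm{Solv}(\mathrm{PSL}(2, q))| = 2q^2$.
   Context: For a finite group $G$ and $x \in G$, the solvabilizer of $x$ in $G$ is $\mathrm{Sol}_G(x) = \{y \in G : \langle x, y \rangle \text{ is solvable}\}$. $\mathrm{Solv}(G) = \{\mathrm{Sol}_G(x) : x \in G\}$ is the set of distinct solvabilizers of elements of $G$, and $|\mathrm{Solv}(G)|$ is its cardinality. *)

(* Defs.v *)
From mathcomp Require Import all_boot all_order all_algebra all_fingroup all_solvable.
Set Implicit Arguments. Unset Strict Implicit. Unset Printing Implicit Defensive.
Import GRing.Theory.
Local Open Scope group_scope.

Definition Sol (gT : finGroupType) (G : {set gT}) (x : gT) : {set gT} :=
  [set y in G | solvable <<[set x; y]>>].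

Definition Solv (gT : finGroupType) (G : {set gT}) : {set {set gT}} :=
  [set Sol G x | x in G].

Definition SL2set (F : finFieldType) : {set {'GL_2[F]}} :=
  [set g : {'GL_2[F]} | (\det (GLval g) == 1)%R].

Lemma SL2_group_set (F : finFieldType) : group_set (SL2set F).
Proof.
apply/group_setP; split; first by rewrite inE GL_1E det1.
move=> x y; rewrite !inE => /eqP dx /eqP dy.
by rewrite GL_ME det_mulmx dx dy mulr1.
Qed.

Canonical SL2_group (F : finFieldType) := Group (SL2_group_set F).

Definition PSL2 (F : finFieldType) := (SL2_group F / 'Z(SL2_group F))%g.

(* Main.v *)
Require Import Defs.
From mathcomp Require Import all_boot all_order all_algebra all_fingroup all_solvable.
From mathcomp Require Import all_field ring.

(** In characteristic 2 the centre of SL_2(F) is trivial, so PSL_2(F) may be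
    replaced by SL_2(F). There <x, z> is solvable iff either det (xz - zx) = 0
    (x and z commute or share an eigenline) or two of tr x, tr z, tr (xz)
    vanish (<x, z> is dihedral). For the direct implication, take a <> 1 in a
    minimal normal subgroup A of <x, z>; A is abelian, so x and z conjugate a
    into the algebra F[a]. If tr a = 0 they fix the unique eigenline of a;
    otherwise they map a to a or to its inverse, and the elements inverting a
    have trace 0.

    Testing this criterion against transvections and against elements of nonzero
    trace shows that Sol(x) determines, and is determined by, the
    following code of x: whether tr x = 0, together with the two off-diagonal
    entries of x, divided by tr x when tr x <> 0. When |F| > 2 every element of
    bool * F * F is such a code, hence there are 2 |F|^2 solvabilizers. *)

Set Implicit Arguments. Unset Strict Implicit. Unset Printing Implicit Defensive.
Import GRing.Theory.

Local Open Scope group_scope.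

(** * Groups of exponent 2 and dihedral groups *)

Lemma exponent2_abelian (gT : finGroupType) (G : {group gT}) :
  {in G, forall x, (x * x = 1)%g} -> abelian G.
Proof.
move=> sq1; apply/centsP=> x Gx y Gy; apply: (mulgI x); apply: (mulIg y).
have := sq1 _ (groupM Gx Gy); rewrite !mulgA => e; rewrite sq1 // mul1g sq1 //.
Qed.

(** The element x inverts x y, so <x y> is normal, and the quotient by it is cyclic, generated by
    the image of x. *)
Lemma dihedral_solvable (gT : finGroupType) (x y : gT) :
  (x * x = 1 -> y * y = 1 -> solvable <<[set x; y]>>)%g.
Proof.
move=> x2 y2.
have xV : (x^-1 = x)%g by apply/eqP; rewrite eq_invg_mul x2.
have yV : (y^-1 = y)%g by apply/eqP; rewrite eq_invg_mul y2.
have nC : <[x]> \subset 'N(<[(x * y)%g]>).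
  rewrite cycle_subG; apply/normP; rewrite -cycleJ.
  by rewrite conjgE xV mulgA mulgA x2 mul1g -{1}yV -{1}xV -invMg cycleV.
have -> : <<[set x; y]>> = <[x * y]> <*> <[x]>.
  apply/eqP; rewrite eqEsubset gen_subG join_subG !cycle_subG subUset !sub1set.
  have xJ : x \in <[x * y]> <*> <[x]> by rewrite mem_gen // inE cycle_id orbT.
  have xyJ : x * y \in <[x * y]> <*> <[x]> by rewrite mem_gen // inE cycle_id.
  have xG : x \in <<[set x; y]>> by rewrite mem_gen ?set21.
  have yG : y \in <<[set x; y]>> by rewrite mem_gen ?set22.
  rewrite xJ xG (groupM xG yG) !andbT /=.
  by have := groupM (groupVr xJ) xyJ; rewrite mulKg.
have nCJ : <[x * y]> <| <[x * y]> <*> <[x]> by rewrite normalYl.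
rewrite (series_sol nCJ).
rewrite abelian_sol ?cycle_abelian // quotientYidl //.
by rewrite quotient_sol // abelian_sol // cycle_abelian.
Qed.

Local Open Scope ring_scope.

(** * Algebra of 2 x 2 matrices *)

Lemma ord2P (P : 'I_2 -> Type) : P 0 -> P 1 -> forall i, P i.
Proof.
move=> P0 P1; case=> [[|[|]]] //= hi.
  by rewrite (_ : Ordinal hi = 0) //; apply: val_inj.
by rewrite (_ : Ordinal hi = 1) //; apply: val_inj.
Qed.

Lemma mx22_eqP (R : Type) (A B : 'M[R]_2) :
  A 0 0 = B 0 0 -> A 0 1 = B 0 1 -> A 1 0 = B 1 0 -> A 1 1 = B 1 1 -> A = B.
Proof.
by move=> h00 h01 h10 h11; apply/matrixP; apply: ord2P; apply: ord2P.
Qed.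

Lemma sum_ord2 (R : nmodType) (f : 'I_2 -> R) : \sum_i f i = f 0 + f 1.
Proof.
rewrite !big_ord_recl big_ord0 addr0.
by congr (_ + f _); apply: val_inj.
Qed.

Lemma mulmx22E (R : pzRingType) (A B : 'M[R]_2) i j :
  (A *m B) i j = A i 0 * B 0 j + A i 1 * B 1 j.
Proof. by rewrite mxE sum_ord2. Qed.

Lemma mxtrace22 (R : nmodType) (A : 'M[R]_2) : \tr A = A 0 0 + A 1 1.
Proof. exact: sum_ord2. Qed.

Lemma det22 (R : comPzRingType) (A : 'M[R]_2) :
  \det A = A 0 0 * A 1 1 - A 0 1 * A 1 0.
Proof.
rewrite (expand_det_row _ 0) sum_ord2 /cofactor !det_mx11 !mxE /=.
have h0 : lift 0 0 = 1 :> 'I_2 by apply: val_inj.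
have h1 : lift 1 0 = 0 :> 'I_2 by apply: val_inj.
by rewrite h0 h1 expr0 expr1 mul1r mulN1r mulrN.
Qed.

(** Derives one identity from another when [ring] can check that both have the same difference of
    sides. *)
Lemma eq_lin (V : zmodType) (a b c d : V) : c = d -> a - b = c - d -> a = b.
Proof. by move=> -> /eqP; rewrite subrr subr_eq0 => /eqP. Qed.

Definition mx22 (R : Type) (a b c d : R) : 'M[R]_2 :=
  \matrix_(i, j) if i == 0 then (if j == 0 then a else b)
                 else (if j == 0 then c else d).

Lemma mx22E (R : Type) (a b c d : R) :
  (mx22 a b c d 0 0 = a) * (mx22 a b c d 0 1 = b) *
  (mx22 a b c d 1 0 = c) * (mx22 a b c d 1 1 = d).
Proof. by rewrite !mxE. Qed.

Lemma mulmx22_CayleyHamilton (R : comPzRingType) (X : 'M[R]_2) :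
  X *m X = \tr X *: X - (\det X)%:M.
Proof.
by apply: mx22_eqP; rewrite mulmx22E !mxE mxtrace22 det22 /=; ring.
Qed.

(** For determinant 1 this is Fricke's trace identity, the left side being 2 - tr (X Z X^-1
    Z^-1). *)
Lemma det_commutator22 (R : comPzRingType) (X Z : 'M[R]_2) :
  \det (X *m Z - Z *m X) =
    4%:R * \det X * \det Z + \tr X * \tr Z * \tr (X *m Z)
    - \tr X ^+ 2 * \det Z - \tr Z ^+ 2 * \det X - \tr (X *m Z) ^+ 2.
Proof.
have sE (A B : 'M[R]_2) i j : (A - B) i j = A i j - B i j by rewrite !mxE.
by rewrite !det22 !mxtrace22 !sE !mulmx22E; ring.
Qed.

Lemma det_affine22 (R : comPzRingType) (al be : R) (A : 'M[R]_2) :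
  \det (al%:M + be *: A) = al ^+ 2 + al * be * \tr A + be ^+ 2 * \det A.
Proof. by rewrite !det22 mxtrace22 !mxE /=; ring. Qed.

Lemma tr_affine22 (R : comPzRingType) (al be : R) (A : 'M[R]_2) :
  \tr (al%:M + be *: A) = al *+ 2 + be * \tr A.
Proof. by rewrite !mxtrace22 !mxE /=; ring. Qed.

(** Commutation says that the vectors (M 0 1, M 1 0, M 0 0 - M 1 1), for M = A and M = B, have zero
    cross product. The one of A is nonzero since A is not scalar, so the one of B is a multiple of
    it. *)
Lemma comm22_affine (F : fieldType) (A B : 'M[F]_2) :
  ~~ is_scalar_mx A -> A *m B = B *m A -> exists al be, B = al%:M + be *: A.
Proof.
move=> nsA cAB.
have e i j : (A *m B) i j = (B *m A) i j by rewrite cAB.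
move: (e 0 0) (e 0 1) (e 1 0); rewrite !mulmx22E => e00 e01 e10.
suff [be [h1 h2 h3]] : exists be, [/\ B 0 1 = be * A 0 1,
  B 1 0 = be * A 1 0 & B 0 0 - B 1 1 = be * (A 0 0 - A 1 1)].
  exists (B 1 1 - be * A 1 1), be.
  by apply: mx22_eqP; rewrite !mxE /= ?h1 ?h2; first apply: (eq_lin h3); ring.
have [a01|a01] := eqVneq (A 0 1) 0; last first.
  exists (B 0 1 / A 0 1); split; first by rewrite divfK.
    by apply: (mulfI a01); rewrite mulrA mulrCA divff // mulr1;
      apply: (eq_lin e00); ring.
  by apply: (mulfI a01); rewrite mulrA mulrCA divff // mulr1;
    apply: (eq_lin (esym e01)); ring.
have [a10|a10] := eqVneq (A 1 0) 0; last first.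
  exists (B 1 0 / A 1 0); split; last 2 first; first by rewrite divfK.
    by apply: (mulfI a10); rewrite mulrA mulrCA divff // mulr1;
      apply: (eq_lin e10); ring.
  by apply: (mulfI a10); rewrite mulrA mulrCA divff // mulr1;
    apply: (eq_lin (esym e00)); ring.
have a0 : A 0 0 - A 1 1 != 0.
  apply: contra nsA; rewrite subr_eq0 => /eqP h; apply/is_scalar_mxP.
  by exists (A 1 1); apply: mx22_eqP; rewrite !mxE.
exists ((B 0 0 - B 1 1) / (A 0 0 - A 1 1)); rewrite a01 a10 !mulr0; split.
- by apply: (mulfI a0); move: e01; rewrite a01 => e01; apply: (eq_lin e01); ring.
- by apply: (mulfI a0); move: e10; rewrite a10 => e10;
    apply: (eq_lin (esym e10)); ring.
- by rewrite divfK.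
Qed.

Lemma ker_rV2 (F : fieldType) (N : 'M[F]_2) (v w : 'rV[F]_2) :
  N != 0 -> v != 0 -> v *m N = 0 -> w *m N = 0 -> exists lam, w = lam *: v.
Proof.
move=> nzN nzv /sub_kermxP vN /sub_kermxP wN; apply/sub_rVP.
apply: submx_trans wN _; rewrite -(geq_leqif (mxrank_leqif_sup vN)).
rewrite mxrank_ker rank_rV nzv leq_subLR addn1 ltnS lt0n.
by rewrite mxrank_eq0.
Qed.

Lemma det_commutator_eigen (F : fieldType) (n : nat) (X Z : 'M[F]_n)
    (v : 'rV[F]_n) lam mu :
  v != 0 -> v *m X = lam *: v -> v *m Z = mu *: v ->
  \det (X *m Z - Z *m X) = 0.
Proof.
move=> nzv vX vZ; apply/eqP/det0P; exists v => //.
by rewrite mulmxBr !mulmxA vX vZ -!scalemxAl vX vZ !scalerA mulrC subrr.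
Qed.

(* For X, Z in SL_2(F) with F finite of characteristic 2, this decides whether
   <X, Z> is solvable. *)
Definition solvable_pair (F : fieldType) (X Z : 'M[F]_2) : bool :=
  (\det (X *m Z - Z *m X) == 0) ||
  [|| (\tr X == 0) && (\tr Z == 0), (\tr X == 0) && (\tr (X *m Z) == 0)
    | (\tr Z == 0) && (\tr (X *m Z) == 0)].

(** * Matrices conjugating A into F[A], in characteristic 2 *)

Lemma conj_commute22 (F : fieldType) (A X B : 'M[F]_2) :
  2 \in [pchar F] -> \det A = 1 -> A != 1%:M -> X \in unitmx ->
  A *m X = X *m B -> A *m B = B *m A ->
  if \tr A == 0 then exists be, (A + 1%:M) *m X = be *: (X *m (A + 1%:M))
  else A *m X = X *m A \/ A *m X = X *m ((\tr A)%:M + A).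
Proof.
move=> ch dA nA1 uX eAX cAB.
have eB : B = invmx X *m A *m X by rewrite -mulmxA eAX mulKmx.
have dB : \det B = 1.
  by rewrite eB !det_mulmx mulrAC -det_mulmx mulVmx // det1 mul1r.
have tB : \tr B = \tr A by rewrite eB -mulmxA mxtrace_mulC mulmxK.
have opp2 (x : F) : - x = x by rewrite oppr_pchar2.
have sqr_inj1 (x : F) : x ^+ 2 = 1 -> x = 1.
  by move/eqP; rewrite sqrf_eq1 opp2 orbb => /eqP.
have nsA : ~~ is_scalar_mx A.
  apply: contra nA1 => /is_scalar_mxP [c ec]; move: dA; rewrite ec det_scalar.
  by move/sqr_inj1 ->.
(* B = X^-1 A X lies in F[A]; having the determinant and the trace of A leaves few choices of al and
   be. *)
have [al [be eBA]] := comm22_affine nsA cAB.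
move: dB tB; rewrite eBA det_affine22 tr_affine22 dA mulr1 => dB tB.
have a2 : al *+ 2 = 0 by rewrite mulr2n addrr_pchar2.
rewrite a2 add0r in tB.
have [tA0|tA] := eqVneq (\tr A) 0.
  rewrite tA0 mulr0 addr0 in dB.
  have /sqr_inj1 ab1 : (al + be) ^+ 2 = 1.
    by rewrite sqrrD -mulrnAl a2 mul0r addr0.
  have ealp : al = 1 + be by rewrite -ab1 -addrA addrr_pchar2 // addr0.
  have XX : X + X = 0 by rewrite -mulr2n -scaler_nat pcharf0 // scale0r.
  exists be; rewrite mulmxDl eAX eBA ealp !mulmxDr mul_mx_scalar.
  rewrite -scalemxAr scalerDl scale1r mul1mx mulmx1 scalerDr.
  by rewrite addrC !addrA XX add0r addrC.
(* The trace gives be = 1, and then the determinant gives al (al + tr A) = 0. The root al = tr A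
   yields B = tr A + A, which is A^-1. *)
have be1 : be = 1 by apply: (mulIf tA); rewrite tB mul1r.
move: dB; rewrite eAX eBA be1 expr1n !mulr1 scale1r => /eqP.
rewrite -[X in _ == X]add0r (inj_eq (addIr 1)) expr2 -mulrDr mulf_eq0 addr_eq0 opp2.
case/orP=> /eqP ->; last by right.
by left; rewrite raddf0 add0r.
Qed.

(** X' and Z' are the conjugates of A by X and Z; the hypotheses hold when A lies in an abelian
    normal subgroup of <X, Z>. *)
Lemma normalized_solvable_pair (F : fieldType) (A X Z X' Z' : 'M[F]_2) :
  2 \in [pchar F] -> \det A = 1 -> A != 1%:M -> X \in unitmx -> Z \in unitmx ->
  A *m X = X *m X' -> A *m X' = X' *m A ->
  A *m Z = Z *m Z' -> A *m Z' = Z' *m A -> solvable_pair X Z.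
Proof.
move=> ch dA nA1 uX uZ eX cX eZ cZ.
have opp2 (x : F) : - x = x by rewrite oppr_pchar2.
have := conj_commute22 ch dA nA1 uX eX cX.
have := conj_commute22 ch dA nA1 uZ eZ cZ.
have [tA0 [be eZb] [ga eXg]|tA] := eqVneq (\tr A) 0.
  have nzN : A + 1%:M != 0.
    apply: contra nA1; rewrite addr_eq0 => /eqP ->; apply/eqP.
    by apply/matrixP=> i j; rewrite !mxE opp2.
  have /eqP/det0P[v nzv vN] : \det (A + 1%:M) = 0.
    rewrite addrC -[A]scale1r det_affine22 tA0 dA !expr1n mulr0 addr0 mulr1.
    by rewrite addrr_pchar2.
  (* W preserves the left kernel of A + 1, which is a line; de is nonzero because W is invertible
     and A + 1 is not zero. *)
  have eig W de : W \in unitmx -> (A + 1%:M) *m W = de *: (W *m (A + 1%:M)) ->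
      exists lam, v *m W = lam *: v.
    move=> uW eW; apply: (ker_rV2 nzN nzv vN).
    have de0 : de != 0.
      apply: contra nzN => /eqP de0; move: eW; rewrite de0 scale0r => eW.
      by rewrite -[A + _](mulmxK uW) eW mul0mx.
    apply: (scalerI de0); rewrite -mulmxA scalemxAr -eW mulmxA vN mul0mx.
    by rewrite scaler0.
  have [lam vX] := eig _ _ uX eXg; have [mu vZ] := eig _ _ uZ eZb.
  by rewrite /solvable_pair (det_commutator_eigen nzv vX vZ) eqxx.
have opp2m (M : 'M[F]_2) : - M = M by apply/matrixP=> i j; rewrite !mxE opp2.
(* Traces of both sides give tr A * tr W = 0. *)
have inv0 W : A *m W = W *m ((\tr A)%:M + A) -> \tr W = 0.
  move=> e; have := congr1 (fun M => \tr M) e.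
  rewrite mulmxDr mxtraceD mul_mx_scalar mxtraceZ [\tr (W *m A)]mxtrace_mulC.
  move/eqP; rewrite -subr_eq subrr eq_sym mulf_eq0 (negPf tA) /=.
  by move/eqP.
have nsA : ~~ is_scalar_mx A.
  apply: contra tA => /is_scalar_mxP [c ->]; rewrite mxtrace_scalar mulr2n.
  by rewrite addrr_pchar2.
(* Each of X and Z centralizes or inverts A. If both centralize it, they lie in the commutative
   algebra F[A]; otherwise exactly two of X, Z, X Z invert A and so have trace 0. *)
rewrite /solvable_pair; case=> eZ2; case=> eX2.
- have [a [b ->]] := comm22_affine nsA eX2.
  have [c [d ->]] := comm22_affine nsA eZ2.
  rewrite (_ : _ - _ = 0) ?det0 ?eqxx //; apply/eqP; rewrite subr_eq0.
  have cP p q M : comm_mx M A -> comm_mx M (p%:M + q *: A).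
    move=> cM; rewrite -mul_scalar_mx.
    by apply: comm_mxD; [|apply: comm_mxM] => //; exact: comm_mx_scalar.
  by apply/comm_mxP/cP/comm_mx_sym/cP.
- rewrite (inv0 _ eX2) (inv0 (X *m Z)) ?eqxx ?orbT //.
  rewrite mulmxA eX2 -!mulmxA; congr (X *m _).
  by rewrite mulmxDl mulmxDr mul_scalar_mx mul_mx_scalar eZ2.
- rewrite (inv0 _ eZ2) (inv0 (X *m Z)) ?eqxx ?orbT //.
  by rewrite mulmxA eX2 -!mulmxA eZ2.
- by rewrite (inv0 _ eX2) (inv0 _ eZ2) eqxx orbT.
Qed.

(** The left side telescopes to X^2 Z - Z X^2, where Cayley-Hamilton replaces X^2 by tr X * X up to
    a scalar matrix, which commutes with Z. *)
Lemma anticommutator22 (R : comPzRingType) (X Z : 'M[R]_2) :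
  X *m (X *m Z - Z *m X) + (X *m Z - Z *m X) *m X =
    \tr X *: (X *m Z - Z *m X).
Proof.
rewrite mulmxBr mulmxBl !mulmxA addrA subrK -(mulmxA Z).
rewrite mulmx22_CayleyHamilton mulmxBl mulmxBr mul_scalar_mx mul_mx_scalar.
by rewrite -scalemxAl -scalemxAr opprB addrA subrK scalerBr.
Qed.

(** * Solvability of <x, z> in SL_2(F) *)

Section SL2.
Variable F : finFieldType.
Implicit Types (g x z : {'GL_2[F]}) (v : 'rV[F]_2).

Lemma GLval_inj : injective (@GLval 2 F).
Proof. exact: val_inj. Qed.

Lemma solvable_solvable_pair x z :
  2 \in [pchar F] -> \det (GLval x) = 1 -> \det (GLval z) = 1 ->
  solvable <<[set x; z]>> -> solvable_pair (GLval x) (GLval z).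
Proof.
move=> ch dx dz sol.
have [G1|ntG] := eqVneq <<[set x; z]>>%g 1%g.
  have e1 y : y \in [set x; z] -> y = 1%g.
    by move=> /mem_gen; rewrite G1 => /set1P.
  by rewrite /solvable_pair (e1 x) ?set21 // (e1 z) ?set22 // subrr det0 eqxx.
have [A minA sAG] := minnormal_exists ntG (normG _).
have [nAG ntA /is_abelemP [p pr_p /abelem_abelian cAA]] :=
  minnormal_solvable minA sAG sol.
have /trivgPn [a Aa na1] := ntA.
have da : \det (GLval a) = 1.
  have : a \in SL2_group F.
    apply: subsetP Aa; apply: subset_trans sAG _; rewrite gen_subG subUset !sub1set !inE.
    by rewrite dx dz eqxx.
  by rewrite inE => /eqP.
have conjA y : y \in [set x; z] ->
    GLval a *m GLval y = GLval y *m GLval (a ^ y)%g /\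
    GLval a *m GLval (a ^ y)%g = GLval (a ^ y)%g *m GLval a.
  move=> /mem_gen Hy.
  have Aay : (a ^ y)%g \in A by rewrite memJ_norm // (subsetP nAG).
  by rewrite -!GL_MxE -conjgC (centsP cAA _ Aay _ Aa).
have [ex cx] := conjA x (set21 _ _); have [ez cz] := conjA z (set22 _ _).
have nA1 : GLval a != 1%:M by apply: contra na1 => /eqP e; apply/eqP/GLval_inj.
exact: (normalized_solvable_pair ch da nA1 (GL_unitmx x) (GL_unitmx z)
          ex cx ez cz).
Qed.

Lemma sqr_tr0 x : 2 \in [pchar F] -> \det (GLval x) = 1 ->
  \tr (GLval x) = 0 -> (x * x = 1)%g.
Proof.
move=> ch dx tx; apply: GLval_inj; rewrite GL_MxE mulmx22_CayleyHamilton.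
rewrite dx tx scale0r sub0r; apply/matrixP=> i j.
by rewrite !mxE oppr_pchar2.
Qed.

(** For v <> 0 this is a Borel subgroup, with unipotent radical [vec_stab v]. *)
Definition line_stab v : {set {'GL_2[F]}} :=
  [set g in SL2_group F | (v *m GLval g <= v)%MS].

Lemma line_stab_group_set v : group_set (line_stab v).
Proof.
apply/group_setP; split; first by rewrite inE group1 GL_1E mulmx1 /=.
move=> x y /setIdP[Sx vx] /setIdP[Sy vy]; apply/setIdP.
by rewrite groupM // GL_MxE mulmxA (submx_trans (submxMr _ vx)).
Qed.

Canonical line_stab_group v := Group (line_stab_group_set v).

Definition vec_stab v : {set {'GL_2[F]}} :=
  [set g in SL2_group F | v *m GLval g == v].

Lemma vec_stab_group_set v : group_set (vec_stab v).
Proof.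
apply/group_setP; split; first by rewrite inE group1 GL_1E mulmx1 /=.
move=> x y /setIdP[Sx /eqP vx] /setIdP[Sy vy]; apply/setIdP.
by rewrite groupM // GL_MxE mulmxA vx.
Qed.

Canonical vec_stab_group v := Group (vec_stab_group_set v).

(** Both x y and y x multiply v by the same product of eigenvalues, which is nonzero when v is, so
    their commutator fixes v. *)
Lemma line_stab_der1 v : ((line_stab v)^`(1) \subset vec_stab v)%g.
Proof.
rewrite gen_subG; apply/subsetP=> _ /imset2P[x y Lx Ly ->].
have /setIdP[Sx /sub_rVP [a va]] := Lx; have /setIdP[Sy /sub_rVP [b vb]] := Ly.
apply/setIdP; rewrite groupR //; split=> //; apply/eqP.
move: [~ x, y]%g (commgC x y) => k ek.
have : v *m GLval (y * x * k)%g = v *m GLval (y * x)%g.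
  rewrite -ek !GL_MxE !mulmxA va vb -!scalemxAl va vb !scalerA.
  by rewrite mulrC.
rewrite !GL_MxE !mulmxA vb -!scalemxAl va -!scalemxAl !scalerA => e.
have [->|v0] := eqVneq v 0; first by rewrite mul0mx.
have nz g c : v *m GLval g = c *: v -> c != 0.
  move=> e'; apply: contra v0 => /eqP c0; move: e'; rewrite c0 scale0r => e'.
  by rewrite -[v](mulmxK (GL_unitmx g)) e' mul0mx.
by apply: scalerI e; exact: mulf_neq0 (nz _ _ vb) (nz _ _ va).
Qed.

Lemma line_stab_solvable v : 2 \in [pchar F] -> v != 0 ->
  solvable (line_stab v).
Proof.
(* The derived subgroup fixes v, so its elements have trace 0: it has exponent 2. *)
move=> ch nzv; rewrite (series_sol (der_normal 1 _)) andbC.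
rewrite (abelian_sol (der_abelian 0 _)) /=.
apply: solvableS (line_stab_der1 v) _; apply: abelian_sol.
apply: exponent2_abelian => x /setIdP[]; rewrite inE => /eqP dx /eqP vx.
apply: sqr_tr0 => //.
have /eqP : \det (1%:M + 1 *: GLval x) = 0.
  apply/eqP/det0P; exists v => //; rewrite scale1r mulmxDr mulmx1 vx.
  by rewrite -mulr2n -scaler_nat pcharf0 // scale0r.
rewrite det_affine22 dx !expr1n !mul1r addrAC addrr_pchar2 // add0r.
by move/eqP.
Qed.

Lemma solvable_pair_solvable x z :
  2 \in [pchar F] -> \det (GLval x) = 1 -> \det (GLval z) = 1 ->
  solvable_pair (GLval x) (GLval z) -> solvable <<[set x; z]>>.
Proof.
move=> ch dx dz.
have dxz : \det (GLval (x * z)%g) = 1 by rewrite GL_MxE det_mulmx dx dz mulr1.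
case/orP=> [det0|]; last first.
  (* Any two of x, z, x z generate <x, z>, and elements of trace 0 square to 1. *)
  rewrite (_ : GLval x *m GLval z = GLval (x * z)%g) //;
    case/or3P=> /andP[/eqP t1 /eqP t2].
  - by apply: dihedral_solvable; apply: sqr_tr0.
  - have -> : (<<[set x; z]>> = <<[set x; x * z]>>)%g.
      apply/eqP; rewrite eqEsubset !gen_subG !subUset !sub1set.
      have h : x \in <<[set x; x * z]>>%g by rewrite mem_gen ?set21.
      have h' : (x * z)%g \in <<[set x; x * z]>>%g by rewrite mem_gen ?set22.
      have := groupM (groupVr h) h'; rewrite mulKg h => ->.
      by rewrite groupM ?mem_gen ?set21 ?set22.
    by apply: dihedral_solvable; apply: sqr_tr0.
  - have -> : (<<[set x; z]>> = <<[set z; x * z]>>)%g.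
      apply/eqP; rewrite eqEsubset !gen_subG !subUset !sub1set.
      have h : z \in <<[set z; x * z]>>%g by rewrite mem_gen ?set21.
      have h' : (x * z)%g \in <<[set z; x * z]>>%g by rewrite mem_gen ?set22.
      have := groupM h' (groupVr h); rewrite mulgK h => ->.
      by rewrite groupM ?mem_gen ?set21 ?set22.
    by apply: dihedral_solvable; apply: sqr_tr0.
(* Since X N + N X = (tr X) N for N = X Z - Z X, and likewise for Z, both X and
   Z preserve the left kernel of N, which is a line as soon as N <> 0. *)
set N := GLval x *m GLval z - GLval z *m GLval x in det0.
have [N0|nzN] := eqVneq N 0.
  have cxz : commute x z.
    by apply/GLval_inj/eqP; rewrite !GL_MxE -subr_eq0 -/N N0.
  apply: abelian_sol; rewrite abelian_gen.
  apply/centsP=> a /set2P[]-> b /set2P[]-> //; exact/commute_sym.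
have /det0P [v nzv vN] := det0.
have opp2 (c : F) : - c = c by rewrite oppr_pchar2.
have trN : \tr N = 0 by rewrite raddfB /= mxtrace_mulC subrr.
have anti W c : W *m N + N *m W = c *: N -> (v *m W <= v)%MS.
  move=> e; apply/sub_rVP; apply: (ker_rV2 nzN nzv vN).
  have := congr1 (mulmx v) e.
  by rewrite mulmxDr !mulmxA vN mul0mx addr0 -scalemxAr vN scaler0.
have sub : <<[set x; z]>> \subset line_stab v.
  rewrite gen_subG subUset !sub1set !inE dx dz eqxx /=.
  rewrite (anti _ _ (anticommutator22 _ _)) (anti _ (\tr (GLval z))) //.
  have := anticommutator22 (GLval z) (GLval x); rewrite -opprB -/N.
  by rewrite mulmxN mulNmx -opprD scalerN => /oppr_inj.
exact: solvableS sub (line_stab_solvable ch nzv).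
Qed.
End SL2.

(** * The criterion in terms of traces, and the code of a matrix *)

Section Char2.
Variable F : finFieldType.
Hypothesis ch : 2 \in [pchar F].
Implicit Types (X Y Z : 'M[F]_2) (u p be : F).

Let opp2 u : - u = u. Proof. exact: oppr_pchar2. Qed.

Lemma sqr_inj2 : injective (fun u => u ^+ 2).
Proof. by move=> u w /eqP; rewrite eqf_sqr opp2 orbb => /eqP. Qed.

Lemma exists_sqrt2 u : exists w, w ^+ 2 = u.
Proof. by exists (invF sqr_inj2 u); exact: (f_invF sqr_inj2). Qed.

Lemma solvable_pairE X Z : \det X = 1 -> \det Z = 1 ->
  let a := \tr X in let b := \tr Z in let c := \tr (X *m Z) in
  solvable_pair X Z = (a * b * c + a ^+ 2 + b ^+ 2 + c ^+ 2 == 0) ||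
    [|| (a == 0) && (b == 0), (a == 0) && (c == 0) | (b == 0) && (c == 0)].
Proof.
move=> dX dZ /=; rewrite /solvable_pair det_commutator22 dX dZ !mulr1 !opp2.
have -> : 4%:R = 0 :> F by rewrite -[4%N]/(2 * 2)%N natrM (pcharf0 ch) mul0r.
by rewrite add0r.
Qed.

(** Membership in the prime field. When exactly one of X, Z has trace 0, the criterion reduces to
    this test on tr (X Z) divided by the other trace: the value 1 means a singular commutator, the
    value 0 the dihedral case. *)
Definition zero_or_one u := (u == 0) || (u == 1).

Lemma sqrD_eq0 u w : (u ^+ 2 + w ^+ 2 == 0) = (u == w).
Proof. by rewrite addr_eq0 opp2 (inj_eq sqr_inj2). Qed.

Lemma solvable_pair_trl0 X Z : \det X = 1 -> \det Z = 1 ->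
  \tr X = 0 -> \tr Z != 0 ->
  solvable_pair X Z = zero_or_one (\tr (X *m Z) / \tr Z).
Proof.
move=> dX dZ tX tZ; rewrite solvable_pairE // tX eqxx (negPf tZ) !mul0r.
rewrite expr0n /= !add0r orbF sqrD_eq0 eq_sym orbC /zero_or_one.
rewrite mulf_eq0 invr_eq0 (negPf tZ) orbF; congr (_ || _).
by rewrite -[RHS](inj_eq (mulIf tZ)) divfK // mul1r.
Qed.

Lemma solvable_pair_trr0 X Z : \det X = 1 -> \det Z = 1 ->
  \tr X != 0 -> \tr Z = 0 ->
  solvable_pair X Z = zero_or_one (\tr (X *m Z) / \tr X).
Proof.
move=> dX dZ tX tZ; rewrite solvable_pairE // tZ eqxx (negPf tX) mulr0 mul0r.
rewrite expr0n /= add0r addr0 sqrD_eq0 eq_sym orbC /zero_or_one.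
rewrite mulf_eq0 invr_eq0 (negPf tX) orbF; congr (_ || _).
by rewrite -[RHS](inj_eq (mulIf tX)) divfK // mul1r.
Qed.

Lemma solvable_pair_tr00 X Z : \tr X = 0 -> \tr Z = 0 -> solvable_pair X Z.
Proof. by move=> tX tZ; rewrite /solvable_pair tX tZ eqxx orbT. Qed.

(* The solvabilizer of X in SL_2(F) depends on this code only. When tr X <> 0
   it determines the algebra F[X], that is, the torus centralizing X. *)
Definition sol_code X : bool * (F * F) :=
  if \tr X == 0 then (true, (X 0 1, X 1 0))
  else (false, (X 0 1 / \tr X, X 1 0 / \tr X)).

Lemma tr22_eq0 X : (\tr X == 0) = (X 0 0 == X 1 1).
Proof. by rewrite mxtrace22 addr_eq0 opp2. Qed.

Lemma sol_code_solvable_pair X Y Z : \det X = 1 -> \det Y = 1 ->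
  sol_code X = sol_code Y -> solvable_pair X Z = solvable_pair Y Z.
Proof.
move=> dX dY; rewrite /sol_code.
have [tX|tX] := eqVneq (\tr X) 0; have [tY|tY] := eqVneq (\tr Y) 0 => // -[e01 e10].
  (* With trace 0 the diagonal is constant, and its square is 1 + X 0 1 * X 1 0, so the code
     determines X. *)
  suff -> : X = Y by [].
  move/eqP: tX; rewrite tr22_eq0 => /eqP tX.
  move/eqP: tY; rewrite tr22_eq0 => /eqP tY.
  have e00 : X 0 0 = Y 0 0.
    apply: sqr_inj2; rewrite /= !expr2 {2}tX {2}tY.
    by apply: (addIr (- (X 0 1 * X 1 0))); rewrite {2}e01 {2}e10 -!det22 dX dY.
  by apply: mx22_eqP; rewrite // -tX -tY.
(* Equal codes give Y = a + b X. Replacing X by Y then multiplies the commutator with Z by b and,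
   when tr Z = 0, also the trace of the product. *)
pose b := \tr Y / \tr X.
have nzb : b != 0 by rewrite mulf_neq0 ?invr_eq0.
have [a eY] : exists a, Y = a%:M + b *: X.
  exists (Y 0 0 - b * X 0 0); apply: mx22_eqP; rewrite !mxE /= ?add0r ?subrK //.
  - by rewrite -mulrA (mulrC _ (X 0 1)) e01 mulrCA divff ?mulr1.
  - by rewrite -mulrA (mulrC _ (X 1 0)) e10 mulrCA divff ?mulr1.
  - have : b * \tr X = \tr Y by rewrite divfK.
    rewrite !mxtrace22 => e.
    rewrite -[Y 1 1](addKr (Y 0 0)) -e opp2 -[in RHS](opp2 (b * X 0 0)) opp2.
    by rewrite mulrDr opp2 addrA.
have tYZ : \tr Z = 0 -> \tr (Y *m Z) = b * \tr (X *m Z).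
  move=> tZ; rewrite eY mulmxDl mxtraceD mul_scalar_mx mxtraceZ tZ mulr0 add0r.
  by rewrite -scalemxAl mxtraceZ.
have -> : solvable_pair Y Z = (b ^+ 2 * \det (X *m Z - Z *m X) == 0) ||
     ((\tr Z == 0) && (\tr (Y *m Z) == 0)).
  rewrite /solvable_pair (negPf tY) /= -detZ {1 2}eY; congr ((\det _ == 0) || _).
  rewrite mulmxDl mulmxDr mul_scalar_mx mul_mx_scalar opprD addrACA subrr add0r.
  by rewrite -scalemxAl -scalemxAr scalerBr.
rewrite /solvable_pair (negPf tX) /= mulf_eq0 expf_eq0 (negPf nzb) /=.
congr (_ || _); have [tZ|//] := eqVneq (\tr Z) 0.
by rewrite tYZ // mulf_eq0 (negPf nzb).
Qed.
End Char2.

(** * Recovering the code from the solvabilizer *)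

Section Counting.
Variable F : finFieldType.
Hypothesis ch : 2 \in [pchar F].
Hypothesis F_gt2 : (2 < #|F|)%N.
Implicit Types (X Y Z : 'M[F]_2) (u p be : F).

Let opp2 u : - u = u. Proof. exact: oppr_pchar2. Qed.
Let addrr2 u : u + u = 0. Proof. exact: addrr_pchar2. Qed.

Lemma exists_not_zero_or_one : exists c : F, ~~ zero_or_one c.
Proof.
have /card_gt0P [c] : (0 < #|~: [set 0%R; 1%R : F]|)%N.
  by rewrite cardsCs setCK cards2 eq_sym oner_eq0 subn_gt0.
by rewrite !inE; exists c.
Qed.

(** A zero slope gives a constant test, whereas a nonzero slope gives both answers as |F| > 2. If
    both slopes are nonzero, the points p / be and (p + 1) / be pass the first test, hence the
    second; their images there differ by be' / be, a nonzero element of {0, 1}. *)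
Lemma zero_or_one_affine_slope p p' be be' :
  (forall w, zero_or_one (p + be * w) = zero_or_one (p' + be' * w)) -> be = be'.
Proof.
have aux (q q' de de' : F) : de = 0 -> de' != 0 ->
    ~ forall w, zero_or_one (q + de * w) = zero_or_one (q' + de' * w).
  move=> -> nz h; have [c] := exists_not_zero_or_one.
  have e (w : F) : zero_or_one w = zero_or_one q.
    have := h ((w - q') / de'); rewrite mul0r addr0 mulrCA divff // mulr1.
    by rewrite addrC subrK.
  by rewrite e -(e 0) /zero_or_one eqxx.
have [be0|nbe] := eqVneq be 0; have [be0'|nbe'] := eqVneq be' 0 => h.
- by rewrite be0 be0'.
- by have /(_ h) := aux p p' _ _ be0 nbe'.
- by case: (aux p' p _ _ be0' nbe) => w; rewrite h.
have h0 : zero_or_one (p' + be' * (p / be)).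
  by rewrite -h mulrCA divff // mulr1 addrr2 /zero_or_one eqxx.
have h1 : zero_or_one (p' + be' * ((p + 1) / be)).
  by rewrite -h mulrCA divff // mulr1 addrA addrr2 add0r /zero_or_one eqxx orbT.
have e : be' / be = (p' + be' * (p / be)) + (p' + be' * ((p + 1) / be)).
  by rewrite addrACA addrr2 add0r -mulrDr -mulrDl addrA addrr2 add0r mul1r.
suff /divr1_eq : be' / be = 1 by [].
have : be' / be != 0 by rewrite mulf_neq0 ?invr_eq0.
rewrite e; case/orP: h0 => /eqP ->; case/orP: h1 => /eqP ->.
all: by rewrite ?addrr2 ?addr0 ?add0r ?eqxx.
Qed.

Lemma mxtrace_mul22 X Z : \tr (X *m Z) =
  X 0 0 * Z 0 0 + X 0 1 * Z 1 0 + (X 1 0 * Z 0 1 + X 1 1 * Z 1 1).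
Proof. by rewrite mxtrace22 !mulmx22E. Qed.

Lemma sol_code_surj (c : bool * (F * F)) : exists2 X, \det X = 1 & sol_code X = c.
Proof.
case: c => [[] [be ga]].
  have [p ep] := exists_sqrt2 ch (1 + be * ga).
  exists (mx22 p be ga p); first by rewrite det22 !mx22E -expr2 ep addrK.
  by rewrite /sol_code (tr22_eq0 ch) !mx22E eqxx.
(* Normalize M = [t, be; ga, t + 1], of trace 1, to determinant 1. *)
have [t nzt] : exists t, t ^+ 2 + t + be * ga != 0.
  have [bg0|] := eqVneq (be * ga) 0; last first.
    by exists 0; rewrite expr0n !add0r.
  (* Now det M = t (t + 1), so t must avoid 0 and 1. *)
  have [c nc] := exists_not_zero_or_one.
  exists c; rewrite bg0 addr0 expr2 -{3}[c]mulr1 -mulrDr mulf_eq0 addr_eq0 opp2.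
  by [].
(* Scaling M by w makes its determinant 1 and its trace w, so dividing by the trace returns be and
   ga. *)
have [w ew] := exists_sqrt2 ch (t ^+ 2 + t + be * ga)^-1.
have nzw : w != 0.
  by apply: contra nzt => /eqP w0; rewrite -invr_eq0 -ew w0 expr0n.
have trE : \tr (mx22 (w * t) (w * be) (w * ga) (w * (t + 1))) = w.
  by rewrite mxtrace22 !mx22E -mulrDr addrA addrr2 add0r mulr1.
exists (mx22 (w * t) (w * be) (w * ga) (w * (t + 1))).
  rewrite det22 !mx22E opp2 -[RHS](mulVf nzt) -ew; ring.
rewrite /sol_code trE (negPf nzw) !mx22E.
by rewrite [w * be]mulrC [w * ga]mulrC !mulfK.
Qed.

(** Letting q vary over these transvections, the slope of the test reveals one code entry of X; the
    lower ones reveal the other. *)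
Lemma solvable_pair_upper X q : \det X = 1 -> \tr X != 0 ->
  solvable_pair X (mx22 1 q 0 1) = zero_or_one (1 + X 1 0 / \tr X * q).
Proof.
move=> dX tX; rewrite solvable_pair_trr0 //; last 2 first.
- by rewrite det22 !mx22E mulr0 subr0 mulr1.
- by rewrite mxtrace22 !mx22E addrr2.
rewrite mxtrace_mul22 !mx22E !mulr1 mulr0 addr0 addrCA addrC.
by rewrite -mxtrace22 mulrDl divff // mulrAC.
Qed.

Lemma solvable_pair_lower X q : \det X = 1 -> \tr X != 0 ->
  solvable_pair X (mx22 1 0 q 1) = zero_or_one (1 + X 0 1 / \tr X * q).
Proof.
move=> dX tX; rewrite solvable_pair_trr0 //; last 2 first.
- by rewrite det22 !mx22E mul0r subr0 mulr1.
- by rewrite mxtrace22 !mx22E addrr2.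
rewrite mxtrace_mul22 !mx22E !mulr1 mulr0 add0r addrAC.
by rewrite -mxtrace22 mulrDl divff // mulrAC.
Qed.

(** X passes the test with every Z of trace 0. If Y did too, transvections would force Y to be
    diagonal, and one more Z of trace 0 gives a contradiction. *)
Lemma solvable_pair_tr0_neq X Y : \det X = 1 -> \det Y = 1 ->
  \tr X = 0 -> \tr Y != 0 ->
  ~ forall Z, \det Z = 1 -> solvable_pair X Z = solvable_pair Y Z.
Proof.
move=> dX dY tX tY eXY.
have sY Z : \det Z = 1 -> \tr Z = 0 -> solvable_pair Y Z.
  by move=> dZ tZ; rewrite -eXY // solvable_pair_tr00.
have z1 q : zero_or_one (1 + 0 * q) by rewrite mul0r addr0 /zero_or_one eqxx orbT.
have y10 : Y 1 0 = 0.
  suff /esym/eqP : 0 = Y 1 0 / \tr Y.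
    by rewrite mulf_eq0 invr_eq0 (negPf tY) orbF => /eqP.
  apply: (@zero_or_one_affine_slope 1 1) => q; rewrite z1 -solvable_pair_upper //.
  by rewrite sY // ?det22 ?mxtrace22 !mx22E ?addrr2 // mulr0 subr0 mulr1.
have y01 : Y 0 1 = 0.
  suff /esym/eqP : 0 = Y 0 1 / \tr Y.
    by rewrite mulf_eq0 invr_eq0 (negPf tY) orbF => /eqP.
  apply: (@zero_or_one_affine_slope 1 1) => q; rewrite z1 -solvable_pair_lower //.
  by rewrite sY // ?det22 ?mxtrace22 !mx22E ?addrr2 // mul0r subr0 mulr1.
(* For diagonal Y and Z of constant diagonal p, tr (Y Z) / tr Y = p; the other entries of Z serve to
   make its determinant 1. *)
have [p np] := exists_not_zero_or_one; case/negP: (np).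
have dZ : \det (mx22 p 1 (p ^+ 2 + 1) p) = 1.
  by rewrite det22 !mx22E mul1r -expr2 opprD addrA subrr add0r opp2.
have tZ : \tr (mx22 p 1 (p ^+ 2 + 1) p) = 0 by rewrite mxtrace22 !mx22E.
have := sY _ dZ tZ; rewrite solvable_pair_trr0 // mxtrace_mul22 !mx22E y10 y01.
by rewrite !mul0r add0r addr0 -mulrDl -mxtrace22 mulrAC divff // mul1r.
Qed.

Lemma solvable_pair_sol_code X Y : \det X = 1 -> \det Y = 1 ->
  (forall Z, \det Z = 1 -> solvable_pair X Z = solvable_pair Y Z) ->
  sol_code X = sol_code Y.
Proof.
move=> dX dY eXY; rewrite /sol_code.
have [tX|tX] := eqVneq (\tr X) 0; have [tY|tY] := eqVneq (\tr Y) 0; last first.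
- congr (_, (_, _)); apply: (@zero_or_one_affine_slope 1 1) => q.
    rewrite -!solvable_pair_lower // eXY //.
    by rewrite det22 !mx22E mul0r subr0 mulr1.
  rewrite -!solvable_pair_upper // eXY //.
  by rewrite det22 !mx22E mulr0 subr0 mulr1.
- by case: (solvable_pair_tr0_neq dY dX tY tX) => Z dZ; rewrite eXY.
- by case: (solvable_pair_tr0_neq dX dY tX tY).
(* Both traces are 0 here, so the tests are elements Z of nonzero trace. Every code (t, w) occurs,
   and the slopes in w and t are the off-diagonal entries of W. *)
have line W t w Z : \det W = 1 -> \tr W = 0 -> \det Z = 1 ->
    sol_code Z = (false, (t, w)) ->
    solvable_pair W Z = zero_or_one (W 0 0 + W 0 1 * w + W 1 0 * t).
  move=> dW tW dZ; rewrite /sol_code; case: eqVneq => // tZ [<- <-].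
  rewrite solvable_pair_trl0 // mxtrace_mul22; congr zero_or_one.
  have /eqP <- : W 0 0 == W 1 1 by rewrite -tr22_eq0 // tW.
  rewrite addrACA (addrC (W 0 1 * _)) addrACA -mulrDr -mxtrace22.
  by rewrite !mulrDl mulfK // addrAC -!mulrA addrA.
have sl t w : zero_or_one (X 0 0 + X 0 1 * w + X 1 0 * t)
            = zero_or_one (Y 0 0 + Y 0 1 * w + Y 1 0 * t).
  have [Z dZ cZ] := sol_code_surj (false, (t, w)).
  by rewrite -(line _ _ _ Z) // -(line _ _ _ Z) // eXY.
congr (_, (_, _)).
  apply: (@zero_or_one_affine_slope (X 0 0) (Y 0 0)) => w.
  by have := sl 0 w; rewrite !mulr0 !addr0.
apply: (@zero_or_one_affine_slope (X 0 0) (Y 0 0)) => t.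
by have := sl t 0; rewrite !mulr0 !addr0.
Qed.
End Counting.

(** * From matrices to SL_2(F) and PSL_2(F) *)

Lemma SL2_of_mx (F : finFieldType) (M : 'M[F]_2) :
  \det M = 1 -> exists2 g, g \in SL2_group F & GLval g = M.
Proof.
move=> dM; have uM : M \is a GRing.unit by rewrite unitmxE dM unitr1.
by exists (FinRing.Unit (uM : (M : 'M_(2.-1.+1)) \is a GRing.unit)) => //;
  rewrite inE /= dM.
Qed.

(** Commuting with two opposite transvections makes g scalar; determinant 1 makes the scalar a
    square root of 1, which is 1 in characteristic 2. *)
Lemma center_SL2_char2 (F : finFieldType) :
  2 \in [pchar F] -> ('Z(SL2_group F) = 1)%g.
Proof.
move=> ch; apply/trivgP/subsetP=> g /centerP[Sg cg]; apply/set1P.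
have cgM (M : 'M[F]_2) : \det M = 1 -> GLval g *m M = M *m GLval g.
  by move=> /SL2_of_mx [h Sh <-]; rewrite -!GL_MxE (cg h Sh).
have dg : \det (GLval g) = 1 by move: Sg; rewrite inE => /eqP.
have := cgM (mx22 1 1 0 1); have := cgM (mx22 1 0 1 1).
rewrite !det22 !mx22E !(mulr0, mulr1, subr0) => /(_ erefl) e1 /(_ erefl) e2.
have := congr1 (fun M : 'M[F]_2 => M 0 0) e1.
have := congr1 (fun M : 'M[F]_2 => M 1 1) e2.
have := congr1 (fun M : 'M[F]_2 => M 0 1) e2.
rewrite !mulmx22E !mx22E !(mulr0, mulr1, mul1r, mul0r, addr0, add0r).
move=> e01 /(canRL (addrK _)); rewrite subrr => e10 /(canRL (addKr _)).
rewrite addNr => g01; move: e01; rewrite addrC => /addrI e00.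
have g1 : GLval g 0 0 = 1.
  move: dg; rewrite det22 -e00 g01 mul0r subr0 -expr2 => /eqP.
  by rewrite sqrf_eq1 oppr_pchar2 // orbb => /eqP.
apply: GLval_inj; rewrite GL_1E.
by apply: mx22_eqP; rewrite ?g01 ?e10 -?e00 ?g1 !mxE.
Qed.

Local Open Scope group_scope.

(** Meant for the quotient map onto PSL_2(F), injective because the centre is trivial. *)
Lemma Sol_injm (gT rT : finGroupType) (D G : {group gT})
    (f : {morphism D >-> rT}) x :
  'injm f -> G \subset D -> x \in G -> Sol (f @* G) (f x) = f @* Sol G x.
Proof.
move=> injf sGD Gx; have Dx := subsetP sGD x Gx.
have sSG : Sol G x \subset G by apply/subsetP=> y /setIdP[].
have solE y : y \in G ->
    solvable <<[set f x; f y]>> = solvable <<[set x; y]>>.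
  move=> Gy; have Dy := subsetP sGD y Gy.
  have sxy : [set x; y] \subset D by rewrite subUset !sub1set Dx.
  rewrite -(injm_sol injf) ?gen_subG // morphim_gen // morphimU.
  by rewrite !morphim_set1.
apply/setP=> z; apply/setIdP/morphimP.
  case=> /morphimP[y Dy Gy ->]; rewrite solE // => sol.
  by exists y => //; rewrite inE Gy.
case=> y Dy /setIdP[Gy sol] ->.
by rewrite mem_morphim // solE.
Qed.

Lemma card_Solv_injm (gT rT : finGroupType) (D G : {group gT})
    (f : {morphism D >-> rT}) :
  'injm f -> G \subset D -> #|Solv (f @* G)| = #|Solv G|.
Proof.
move=> injf sGD.
have -> : Solv (f @* G) = [set f @* (A : {set gT}) | A in Solv G].
  apply/setP=> B; apply/imsetP/imsetP.
    case=> _ /morphimP[x Dx Gx ->] ->; exists (Sol G x); first exact: imset_f.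
    by rewrite Sol_injm.
  case=> _ /imsetP[x Gx ->] ->; exists (f x); last by rewrite Sol_injm.
  exact: mem_morphim (subsetP sGD _ Gx) Gx.
apply: card_in_imset => _ _ /imsetP[x Gx ->] /imsetP[y Gy ->].
by apply: injm_morphim_inj => //; apply: subset_trans sGD;
  apply/subsetP=> z /setIdP[].
Qed.

Lemma Sol_SL2 (F : finFieldType) (x z : {'GL_2[F]}) :
  2 \in [pchar F]%R -> x \in SL2_group F ->
  (z \in Sol (SL2_group F) x) =
    (z \in SL2_group F) && solvable_pair (GLval x) (GLval z).
Proof.
move=> ch; rewrite inE => /eqP dx.
have dz : z \in SL2_group F -> \det (GLval z) = 1%R by rewrite inE => /eqP.
apply/setIdP/andP=> -[Sz h]; split=> //.
  exact: solvable_solvable_pair ch dx (dz Sz) h.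
exact: solvable_pair_solvable ch dx (dz Sz) h.
Qed.

Lemma Sol_SL2_eq (F : finFieldType) (x y : {'GL_2[F]}) :
  2 \in [pchar F]%R -> (2 < #|F|)%N -> x \in SL2_group F -> y \in SL2_group F ->
  (Sol (SL2_group F) x == Sol (SL2_group F) y) =
    (sol_code (GLval x) == sol_code (GLval y)).
Proof.
move=> ch F2 Sx Sy.
have [dx dy] : \det (GLval x) = 1%R /\ \det (GLval y) = 1%R.
  by move: Sx Sy; rewrite !inE => /eqP ? /eqP ?.
apply/eqP/eqP=> [eS | e].
  apply: solvable_pair_sol_code => // Z /SL2_of_mx [z Sz <-].
  have := congr1 (fun A : {set _} => z \in A) eS.
  by rewrite /= !Sol_SL2 // Sz.
apply/setP=> z; rewrite !Sol_SL2 //; congr (_ && _).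
exact: sol_code_solvable_pair.
Qed.

Lemma card_Solv_SL2 (F : finFieldType) :
  2 \in [pchar F]%R -> (2 < #|F|)%N -> #|Solv (SL2_group F)| = (2 * #|F| ^ 2)%N.
Proof.
move=> ch F2; pose G := SL2_group F; pose c g := sol_code (GLval (g : {'GL_2[F]})).
transitivity #|[set c g | g in G]|; last first.
  rewrite (_ : [set _ | _ in _] = setT).
    by rewrite cardsT !card_prod card_bool expnS expn1.
  apply/setP=> k; rewrite in_setT; apply/imsetP.
  have [M dM cM] := sol_code_surj ch F2 k; have [g Sg eg] := SL2_of_mx dM.
  by exists g => //; rewrite /c eg.
(* P is the graph of a bijection between solvabilizers and codes: both projections are injective on
   it. *)
pose P := [set (Sol G g, c g) | g in G].
transitivity #|P|.
  rewrite -(_ : [set p.1 | p in P] = Solv G); last first.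
    by rewrite /P -imset_comp.
  apply: card_in_imset => _ _ /imsetP[x Gx ->] /imsetP[y Gy ->] /= e.
  by congr (_, _) => //; apply/eqP; rewrite -Sol_SL2_eq // -/G e.
rewrite -(_ : [set p.2 | p in P] = [set c g | g in G]); last first.
  by rewrite /P -imset_comp.
apply/esym/card_in_imset => _ _ /imsetP[x Gx ->] /imsetP[y Gy ->] /= e.
by congr (_, _) => //; apply/eqP; rewrite Sol_SL2_eq // -/(c x) e.
Qed.

Close Scope group_scope.
Close Scope ring_scope.

Theorem theorem4p1 (n : nat) (F : finFieldType) :
  2 <= n -> #|F| = 2 ^ n -> #|Solv (PSL2 F)| = 2 * (2 ^ n) ^ 2.
Proof.
move=> n2 cF; have ch : 2 \in [pchar F]%R := card_finPcharP cF isT.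
have F2 : 2 < #|F| by rewrite cF (@leq_trans (2 ^ 2)) // leq_exp2l.
rewrite -cF -card_Solv_SL2 // /PSL2.
apply: card_Solv_injm; last exact: gFnorm.
by rewrite ker_coset; apply/trivgP; exact: center_SL2_char2.
Qed.
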